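(* Let $F^2=BJ^2$ be the pseudo-Finsleroid metric function (defined in the context) with $a^{ij}b_ib_j=-c^2$, $0<c\le1$. In the time-like sector ($\epsilon=1$) and in the space-like sector ($\epsilon=-1$), at every $(x,y)$ with $\nu\ne0$ and $C_hC^h\ne0$, the tensor $$\hat R_i{}^j{}_{mn}=C_h{}^j{}_mC_i{}^h{}_n-C_h{}^j{}_nC_i{}^h{}_m,$$ which describes the curvature of the indicatrix, satisfies, with $\hat R_{ijmn}=g_{jk}\hat R_i{}^k{}_{mn}$, $$\hat R_{ijmn}=-(C_hC^h)X^2\bigl(h_{im}h_{jn}-h_{in}h_{jm}\bigr)+X^2\Bigl(N-\frac1X\Bigr)\Bigl(C_iC_mh_{jn}-C_iC_nh_{jm}+C_jC_nh_{im}-C_jC_mh_{in}\Bigr),$$ where $$\frac1X=N+\epsilon\,\frac{(1-c^2)B}{q\,\nu},\qquad \nu=q-\epsilon(1-c^2)g\,b .$$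
   Context: Let $M$ be an $N$-dimensional smooth manifold with a pseudo-Riemannian metric tensor $a_{ij}(x)$ of signature $(+,-,\dots,-)$ and inverse $a^{ij}$, a 1-form $b_i(x)$ with $a^{ij}b_ib_j=-c(x)^2$, $0<c(x)\le1$, and a scalar field $g(x)$. For $y\in T_xM$ put $$b=b_i(x)y^i,\quad r_{ij}=a_{ij}+b_ib_j,\quad \gamma=r_{ij}y^iy^j,\quad q=\sqrt{|\gamma|},\quad B=\gamma-g\,b\,q-b^2 .$$ Time-like sector ($\epsilon=1$, any real $g$): the $y$ with $\gamma>0$ and $B>0$. There $h=\sqrt{1+g^2/4}$, $G=g/h$, $g_\pm=-\frac12g\pm h$, $B=(b-g_-q)(g_+q-b)$ and $J=\left(\frac{b-g_-q}{g_+q-b}\right)^{-G/4}$. Space-like sector ($\epsilon=-1$, $-2<g<2$): the $y$ with $\gamma<0$ (so $B=-(q^2+gbq+b^2)<0$). There $h=\sqrt{1-g^2/4}$, $G=g/h$, $L=q+\frac g2 b$, $J=e^{-\frac12 G f}$ with $f=-\arctan\frac G2+\arctan\frac{L}{hb}$ if $b<0$, $f=-\pi-\arctan\frac G2+\arctan\frac{L}{hb}$ if $b>0$ and, by continuity, $f=-\frac\pi2-\arctan\frac G2$ if $b=0$. In both sectors $F^2=BJ^2$, $y_i=\frac12\frac{\partial F^2}{\partial y^i}$, $g_{ij}=\frac12\frac{\partial^2F^2}{\partial y^i\partial y^j}$, $(g^{ij})$ is the inverse of $(g_{ij})$, $h_{ij}=g_{ij}-\frac1{F^2}y_iy_j$,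 $C_{ijk}=\frac12\frac{\partial g_{ij}}{\partial y^k}$ (totally symmetric; indices raised with $g^{ij}$, so $C_i{}^j{}_k=g^{jl}C_{ilk}$), $C_i=\frac{\partial}{\partial y^i}\ln\sqrt{|\det(g_{mn})|}=g^{jk}C_{ijk}$, $C^i=g^{ij}C_j$. *)

(* Defs.v *)
From HB Require Import structures.
From mathcomp Require Import all_boot all_order all_algebra.
From mathcomp Require Import all_classical all_reals all_analysis.

Set Implicit Arguments.
Unset Strict Implicit.
Unset Printing Implicit Defensive.

Import Order.TTheory GRing.Theory Num.Theory.
Import numFieldNormedType.Exports.

Local Open Scope classical_set_scope.
Local Open Scope ring_scope.

(* Coordinate conventions: points x of the manifold are represented in a local
   chart, so x ranges over an open set of 'rV[R]_N; a tangent vector y at x is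
   the row of its components y^i, and a 1-form at x is the row of its
   components b_i.  For a tensor, the indices are listed in their left-to-right
   order, whatever their (upper or lower) position. *)

Definition pderiv (R : realType) (N : nat) (i : 'I_N) (f : 'rV[R]_N -> R)
  : 'rV[R]_N -> R := fun y => 'D_(delta_mx 0 i) f y.

Fixpoint Ck_on (R : realType) (N k : nat) (U : set 'rV[R]_N)
    (f : 'rV[R]_N -> R) : Prop :=
  (forall x, U x -> {for x, continuous f}) /\
  if k is k'.+1 then
    forall i : 'I_N, (forall x, U x -> derivable f x (delta_mx 0 i)) /\
                     Ck_on k' U (pderiv i f)
  else True.

Definition smooth_on (R : realType) (N : nat) (U : set 'rV[R]_N)
    (f : 'rV[R]_N -> R) : Prop := forall k, Ck_on k U f.

(* In some basis the symmetric form a is diag(1, -1, ..., -1). *)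
Definition lorentzian (R : realType) (N : nat) (a : 'M[R]_N) : Prop :=
  a^T = a /\
  exists2 P : 'M[R]_N, P \in unitmx &
    P *m a *m P^T = diag_mx (\row_i (if val i == 0%N then 1 else -1)).

Definition form_sqnorm (R : realType) (N : nat) (a : 'M[R]_N) (b : 'rV[R]_N)
  : R := \sum_i \sum_j invmx a i j * b 0 i * b 0 j.

Inductive sector := Timelike | Spacelike.

Section Finsleroid.

(* Values at one point x of the metric tensor a_ij, the 1-form b_i and the
   scalar g; everything below lives on the tangent space at x. *)
Variables (R : realType) (N : nat) (s : sector).
Variables (a : 'M[R]_N) (b : 'rV[R]_N) (g : R).

Implicit Types y : 'rV[R]_N.

Definition eps : R := if s is Timelike then 1 else -1.

Definition bscal y : R := \sum_i b 0 i * y 0 i.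
Definition rform : 'M[R]_N := \matrix_(i, j) (a i j + b 0 i * b 0 j).
Definition gammaf y : R := \sum_i \sum_j rform i j * y 0 i * y 0 j.
Definition qf y : R := Num.sqrt `|gammaf y|.
Definition Bf y : R := gammaf y - g * bscal y * qf y - bscal y ^+ 2.

Definition in_sector y : Prop :=
  match s with
  | Timelike => 0 < gammaf y /\ 0 < Bf y
  | Spacelike => (-2 < g /\ g < 2) /\ gammaf y < 0
  end.

Definition hconst : R := Num.sqrt (1 + eps * (g ^+ 2 / 4)).
Definition Gconst : R := g / hconst.
Definition gplus : R := - (g / 2) + hconst.
Definition gminus : R := - (g / 2) - hconst.

Definition Lf y : R := qf y + g / 2 * bscal y.

(* The jump by pi between b < 0 and b > 0 keeps the angle continuous at b = 0,
   where L / (h b) blows up. *)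
Definition ff y : R :=
  if bscal y < 0 then
    - atan (Gconst / 2) + atan (Lf y / (hconst * bscal y))
  else if 0 < bscal y then
    - pi - atan (Gconst / 2) + atan (Lf y / (hconst * bscal y))
  else - (pi / 2) - atan (Gconst / 2).

Definition Jf y : R :=
  match s with
  | Timelike =>
      ((bscal y - gminus * qf y) / (gplus * qf y - bscal y))
        `^ (- (Gconst / 4))
  | Spacelike => expR (- (Gconst * ff y / 2))
  end.

(* F^2; it is negative in the space-like sector. *)
Definition F2 y : R := Bf y * Jf y ^+ 2.

Definition ylow (i : 'I_N) y : R := pderiv i F2 y / 2.

Definition gmet y : 'M[R]_N := \matrix_(i, j) (pderiv j (pderiv i F2) y / 2).

Definition ginv y : 'M[R]_N := invmx (gmet y).

Definition hang (i j : 'I_N) y : R :=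
  gmet y i j - ylow i y * ylow j y / F2 y.

Definition Ctens (i j k : 'I_N) y : R :=
  pderiv k (fun z => gmet z i j) y / 2.

(* C_i{}^j{}_k = g^{jl} C_{ilk} *)
Definition Cmix (i j k : 'I_N) y : R := \sum_l ginv y j l * Ctens i l k y.

(* By Jacobi's formula this is also the trace g^{jk} C_{ijk}; the determinant
   has constant sign near y when nu != 0. *)
Definition Cvec (i : 'I_N) y : R :=
  pderiv i (fun z => ln (Num.sqrt `|\det (gmet z)|)) y.

Definition Cvec_up (i : 'I_N) y : R := \sum_j ginv y i j * Cvec j y.

Definition Csq y : R := \sum_h Cvec h y * Cvec_up h y.

(* R_i{}^j{}_{mn} *)
Definition Rhat (i j m n : 'I_N) y : R :=
  \sum_h (Cmix h j m y * Cmix i h n y - Cmix h j n y * Cmix i h m y).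

Definition Rhat_low (i j m n : 'I_N) y : R :=
  \sum_k gmet y j k * Rhat i k m n y.

Definition nuf (c : R) y : R := qf y - eps * (1 - c ^+ 2) * g * bscal y.

Definition Xinv (c : R) y : R :=
  N%:R + eps * ((1 - c ^+ 2) * Bf y / (qf y * nuf c y)).

(* Xinv = 0 gives Xf = 0, but then C_i = 0 as well. *)
Definition Xf (c : R) y : R := (Xinv c y)^-1.

End Finsleroid.

(* Main.v *)
Require Import Defs.
From HB Require Import structures.
From mathcomp Require Import all_boot all_order all_algebra.
From mathcomp Require Import all_classical all_reals all_analysis.
From mathcomp Require Import ring lra.

Set Implicit Arguments.
Unset Strict Implicit.
Unset Printing Implicit Defensive.

Import Order.TTheory GRing.Theory Num.Theory.
Import numFieldNormedType.Exports.
Local Open Scope classical_set_scope.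
Local Open Scope ring_scope.

(* In both sectors J depends on y only through t = b/q and satisfies
   d(ln J)/dt = -(g/2) / (eps - g t - t^2).  Writing v_i = r_ij y^j,
   A_i = eps (b/q) v_i - q b_i and p_i = (g / (2 B)) A_i, this ODE gives
   d_i J^2 = 2 p_i J^2 and d_i F^2 = 2 J^2 (v_i - (b + g q) b_i), and then
     h_ij = J^2 (r_ij - v_i v_j / gamma - (eps / B) A_i A_j),
     C_ijk = p_i h_jk + p_j h_ik + p_k h_ij + lam p_i p_j p_k,
   with lam = 4 eps B J^2 / g^2.  By the rank-two determinant formula
   det(g_ij) = det(a_ij) J^(2N) nu / q, so C_i = p_i / X.  Contracting
   h_ij with the raised 1-form b gives p_i p^i, whence
   1 + lam p_i p^i = 1/X - N, and the curvature is a contraction of two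
   copies of C_ijk. *)

(** * Directional derivatives of real-valued functions on a normed space *)

(** Restriction to the line through z along v makes a directional derivative a one-variable one, so
    that the rules for functions of a real variable carry over. *)
Lemma is_derive_line {R : realType} {V W : normedModType R} (f : V -> W)
    (z v : V) (d : W) :
  is_derive z v f d <-> is_derive (0 : R) 1 (fun t => f (t *: v + z)) d.
Proof.
set l := fun t : R => f (t *: v + z).
have E : 'D_1 l 0 = 'D_v f z.
  rewrite /derive; set g1 := fun h => h^-1 *: _; set g2 := fun h => h^-1 *: _.
  suff -> : g1 = g2 by [].
  by rewrite funeqE /g1 /g2 /l => h /=; rewrite addr0 scale0r add0r [_%:A]mulr1.
split=> -[df Df]; split; [exact: (derivable1P f z v).1 | by rewrite E |
  exact: (derivable1P f z v).2 | by rewrite -E].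
Qed.

Lemma is_derive_chain {R : realType} {V : normedModType R} (phi : R -> R)
    (f : V -> R) (z v : V) (df dphi : R) :
  is_derive z v f df -> is_derive (f z) 1 phi dphi ->
  is_derive z v (fun x => phi (f x)) (dphi * df).
Proof.
move=> /is_derive_line Df Dphi; apply/is_derive_line.
apply: (@is_derive1_comp _ phi (fun t => f (t *: v + z))) => //.
by rewrite scale0r add0r.
Qed.

Lemma is_derive_inv {R : realType} {V : normedModType R} (f : V -> R)
    (z v : V) (df : R) : f z != 0 ->
  is_derive z v f df -> is_derive z v (fun x => (f x)^-1) (- df / f z ^+ 2).
Proof.
move=> fz Df; have Dinv : is_derive (f z) 1 (@GRing.inv R) (- (f z ^- 2)).
  apply: (is_derive_eq (@is_deriveV R id (f z) 1 1 fz (is_derive_id _ _))).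
  by rewrite [_ *: _]mulr1.
apply: (is_derive_eq (is_derive_chain Df Dinv)).
by rewrite mulNr mulrC mulNr.
Qed.

Section PointwiseRules.
Variables (R : realType) (V : normedModType R).
Implicit Types (f g : V -> R) (z v : V).

Lemma is_derive_addf f g z v (df dg : R) :
  is_derive z v f df -> is_derive z v g dg ->
  is_derive z v (fun x => f x + g x) (df + dg).
Proof. exact: is_deriveD. Qed.

Lemma is_derive_subf f g z v (df dg : R) :
  is_derive z v f df -> is_derive z v g dg ->
  is_derive z v (fun x => f x - g x) (df - dg).
Proof. exact: is_deriveB. Qed.

Lemma is_derive_const (k : R) z v : is_derive z v (fun=> k) 0.
Proof. exact: is_derive_cst. Qed.

Lemma is_derive_mulf f g z v (df dg : R) :
  is_derive z v f df -> is_derive z v g dg ->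
  is_derive z v (fun x => f x * g x) (df * g z + f z * dg).
Proof.
move=> Df Dg; apply: (is_derive_eq (is_deriveM Df Dg)).
by rewrite /GRing.scale /= addrC mulrC [f z * _]mulrC mulrC [_ * f z]mulrC.
Qed.

Lemma is_derive_mulc f (k : R) z v (df : R) :
  is_derive z v f df -> is_derive z v (fun x => k * f x) (k * df).
Proof.
move=> Df; apply: (is_derive_eq (is_derive_mulf (is_derive_const k z v) Df)).
by rewrite mul0r add0r.
Qed.

Lemma is_derive_divf f g z v (df dg : R) : g z != 0 ->
  is_derive z v f df -> is_derive z v g dg ->
  is_derive z v (fun x => f x / g x) ((df * g z - f z * dg) / g z ^+ 2).
Proof.
move=> gz Df Dg.
by apply: (is_derive_eq (is_derive_mulf Df (is_derive_inv gz Dg))); field.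
Qed.

(** Along a line, linear and quadratic forms are polynomials of degree at most two. This
    differentiates [bscal], [rbil] and [gammaf] without opening their sums. *)
Lemma is_derive_quadratic f z v (d e : R) :
  (forall t, f (t *: v + z) = f z + t * d + t ^+ 2 * e) -> is_derive z v f d.
Proof.
move=> fE; apply/is_derive_line.
have -> : (fun t => f (t *: v + z)) = (fun t => (f z + d * t) + e * (t * t)).
  by apply/funext => t; rewrite fE; ring.
have Did := is_derive_id (0 : R) (1 : R).
have Dlin := is_deriveD (is_derive_cst (f z) (0 : R) 1) (is_deriveZ d Did).
apply: (is_derive_eq (is_deriveD Dlin (is_deriveZ e (is_deriveM Did Did)))).
by rewrite /GRing.scale /=; ring.
Qed.

End PointwiseRules.

(** * The factor J as a function of the slope t = b/q *)

(** The product condition says w = (1 + u x) / (u - x), the cotangent of atan u - atan x. Since x <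
    u, that difference lies in (0, pi), so its complement to pi/2 is in the range of [atan]. This
    merges the branches of the space-like angle. *)
Lemma atan_tan_pi2 {R : realType} (x u w : R) : x < u -> (u - x) * (w - x) = 1 + x ^+ 2 ->
  atan w = pi / 2 - (atan u - atan x).
Proof.
move=> xu H.
have d0 : 0 < atan u - atan x by rewrite subr_gt0 lt_atan.
have := atan_ltpi2 u; have := atan_gtNpi2 x; have := atan_gtNpi2 u; have := atan_ltpi2 x.
move=> h1 h2 h3 h4.
have cu : cos (atan u) != 0 by rewrite gt_eqF // cos_gt0_pihalf // h2 h4.
have cx : cos (atan x) != 0 by rewrite gt_eqF // cos_gt0_pihalf // h1 h3.
have su : sin (atan u) = u * cos (atan u) by rewrite -{2}(atanK u) /tan mulfVK.
have sx : sin (atan x) = x * cos (atan x) by rewrite -{2}(atanK x) /tan mulfVK.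
have ux : u - x != 0 by rewrite gt_eqF // subr_gt0.
rewrite -[RHS]tanK; last by rewrite in_itv /=; apply/andP; split; lra.
congr atan; rewrite /tan !(sinB, cosB) sin_pihalf cos_pihalf su sx.
have -> : w = x + (1 + x ^+ 2) / (u - x) by rewrite -H; field.
set cU := cos _ in cu *; set cX := cos _ in cx *.
rewrite !(mul1r, mul0r, addr0, add0r, subr0).
have -> : u * cU * cX - cU * (x * cX) = (u - x) * (cU * cX) by ring.
have -> : cU * cX + u * cU * (x * cX) = (1 + u * x) * (cU * cX) by ring.
rewrite -mulf_div divff ?mulf_neq0 // mulr1.
by apply: (mulIf ux); rewrite mulrDl !mulfVK //; ring.
Qed.

Section JFactor.
Variables (R : realType) (s : sector) (g : R).
Local Notation e := (eps R s).
Local Notation h := (hconst s g).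

(* In the space-like sector the three-branch angle f is
   - pi / 2 - atan ((t + g / 2) / h). *)
Definition jfactor (t : R) : R :=
  match s with
  | Timelike => ((t - gminus s g) / (gplus s g - t)) `^ (- (Gconst s g / 4))
  | Spacelike => expR (Gconst s g / 2 * (pi / 2 + atan ((t + g / 2) / h)))
  end.

(** In the time-like sector this is B > 0 divided by q^2; in the space-like sector the bounds on g
    already give B the sign it needs. *)
Definition slope_range (t : R) : Prop :=
  match s with
  | Timelike => 0 < 1 - g * t - t ^+ 2
  | Spacelike => -2 < g /\ g < 2
  end.

Lemma hconst_gt0 : (s = Spacelike -> -2 < g /\ g < 2) -> 0 < h.
Proof.
rewrite /hconst sqrtr_gt0; case: s => /= [_ | /(_ erefl) gB]; nra.
Qed.

Lemma hconst_sqr : (s = Spacelike -> -2 < g /\ g < 2) ->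
  h ^+ 2 = 1 + e * (g ^+ 2 / 4).
Proof. by move=> /hconst_gt0; rewrite sqrtr_gt0 => /ltW /sqr_sqrtr. Qed.

End JFactor.

(** The quadratic factors as (t - g_-)(g_+ - t), and the two factors have the positive sum 2h, so a
    positive product makes both positive. *)
Lemma timelike_factor_gt0 (R : realType) (g t : R) :
  0 < 1 - g * t - t ^+ 2 -> 0 < t - gminus Timelike g /\ 0 < gplus Timelike g - t.
Proof.
have H : 0 < hconst Timelike g by apply: hconst_gt0.
have := @hconst_sqr R Timelike g; rewrite /= mul1r => /(_ (fun x => ltac:(discriminate))) h2.
rewrite /gminus /gplus => t0; split; nra.
Qed.

(** Completing the square in t leaves the coefficient 1 - g^2/4 > 0 on q^2. *)
Lemma spacelike_form_lt0 (R : realType) (g t q : R) :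
  -2 < g /\ g < 2 -> 0 < q -> - q ^+ 2 - g * t * q - t ^+ 2 < 0.
Proof.
move=> [g1 g2] q0.
have -> : - q ^+ 2 - g * t * q - t ^+ 2
  = - ((t + g / 2 * q) ^+ 2 + (2 - g) * (g - -2) / 4 * q ^+ 2) by field.
rewrite oppr_lt0 ltr_wpDl ?sqr_ge0 // mulr_gt0 ?exprn_gt0 //.
by rewrite divr_gt0 ?mulr_gt0 // subr_gt0.
Qed.

(** One equation serves both sectors. Time-like: the ratio has logarithmic derivative 2h / ((t -
    g_-)(g_+ - t)), multiplied by -G/4. Space-like: the arctangent has derivative h / (1 + g t +
    t^2), since h^2 + g^2/4 = 1, multiplied by G/2. *)
Lemma is_derive_jfactor (R : realType) (s : sector) (g t : R) :
  slope_range s g t ->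
  is_derive t 1 (jfactor s g)
    (- (g / 2) * jfactor s g t / (eps R s - g * t - t ^+ 2)).
Proof.
case: s => /= [t0 | gB].
- have [h1 h2] := timelike_factor_gt0 t0.
  have H : 0 < hconst Timelike g by apply: hconst_gt0.
  have := @hconst_sqr R Timelike g; rewrite /= mul1r => /(_ (fun x => ltac:(discriminate))) hs.
  have gp : gplus Timelike g - t != 0 by rewrite gt_eqF.
  have D1 : is_derive t 1 (fun x => (x - gminus Timelike g) / (gplus Timelike g - x))
     ((1 * (gplus Timelike g - t) - (t - gminus Timelike g) * (0 - 1)) / (gplus Timelike g - t) ^+ 2).
    apply: is_derive_divf => //.
      apply: (is_derive_eq (is_derive_subf (is_derive_id _ _) (is_derive_const _ _ _))).
      by rewrite subr0.
  have r0 : 0 < (t - gminus Timelike g) / (gplus Timelike g - t) by rewrite divr_gt0.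
  have D := is_derive_chain D1 (is_derive1_powR (- (Gconst Timelike g / 4)) r0).
  apply: (is_derive_eq D).
  rewrite /jfactor powRB ?powRr1 ?ltW ?(gt_eqF r0) ?implybT //.
  set P := _ `^ _; clearbody P.
  have -> : 1 - g * t - t ^+ 2 = (t - gminus Timelike g) * (gplus Timelike g - t).
    by rewrite /gminus /gplus; nra.
  have gm : t - gminus Timelike g != 0 by rewrite gt_eqF.
  have -> : 1 * (gplus Timelike g - t) - (t - gminus Timelike g) * (0 - 1) = 2 * hconst Timelike g.
    by rewrite /gminus /gplus; ring.
  rewrite /Gconst; have h0 : hconst Timelike g != 0 by rewrite gt_eqF.
  by field; rewrite h0 gp gm.
- have H : 0 < hconst Spacelike g by apply: hconst_gt0.
  have := @hconst_sqr R Spacelike g; rewrite /= => /(_ (fun x => gB)) hs.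
  have h0 : hconst Spacelike g != 0 by rewrite gt_eqF.
  have D1 : is_derive t 1 (fun x => (x + g / 2) / hconst Spacelike g) (hconst Spacelike g)^-1.
    rewrite (_ : (fun _ => _) = fun x => (hconst Spacelike g)^-1 * (x + g / 2)); last first.
      by apply/funext => x; rewrite mulrC.
    apply: (is_derive_eq (is_derive_mulc _ (is_derive_addf (is_derive_id _ _) (is_derive_const _ _ _)))).
    by rewrite addr0 mulr1.
  have D2 := is_derive_mulc (Gconst Spacelike g / 2)
     (is_derive_addf (is_derive_const (pi / 2) t 1) (is_derive_chain D1 (is_derive1_atan _))).
  apply: (is_derive_eq (is_derive_chain D2 (is_derive_expR _))).
  rewrite /jfactor; set E := expR _; clearbody E.
  have n1 : -1 - g * t - t ^+ 2 != 0.
    have := spacelike_form_lt0 t gB ltr01.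
    by rewrite !mulr1 expr1n => h; rewrite lt_eqF.
  have n2 : 1 + ((t + g / 2) / hconst Spacelike g) ^+ 2 != 0.
    by rewrite gt_eqF // ltr_pwDl // sqr_ge0.
  have -> : 1 + ((t + g / 2) / hconst Spacelike g) ^+ 2 = - (-1 - g * t - t ^+ 2) / hconst Spacelike g ^+ 2.
    apply: (@mulIf _ (hconst Spacelike g ^+ 2)); first by rewrite expf_neq0.
    by rewrite mulrDl expr_div_n !divfK ?expf_neq0 // hs; field.
  by rewrite /Gconst; field; rewrite n1 h0.
Qed.

Lemma jfactor_gt0 (R : realType) (s : sector) (g t : R) : slope_range s g t -> 0 < jfactor s g t.
Proof.
case: s => /= t0; last exact: expR_gt0.
by have [h1 h2] := timelike_factor_gt0 t0; rewrite powR_gt0 // divr_gt0.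
Qed.

(** * Signs and the shape of J at a point of a sector *)

Section SectorPoint.
Variables (R : realType) (N : nat) (s : sector).
Variables (a : 'M[R]_N) (b : 'rV[R]_N) (g : R) (y : 'rV[R]_N).
Hypothesis ys : in_sector s a b g y.
Local Notation e := (eps R s).
Local Notation q := (qf a b y).
Local Notation beta := (bscal b y).
Local Notation B := (Bf a b g y).

Lemma eps_sqr : e * e = 1.
Proof. by case: s => /=; ring. Qed.

Lemma gammaf_neq0 : gammaf a b y != 0.
Proof. by move: ys; case: s => /= [[h _]|[_ h]]; rewrite ?(gt_eqF h) ?(lt_eqF h). Qed.

Lemma qf_gt0 : 0 < q.
Proof. by rewrite sqrtr_gt0 normr_gt0 gammaf_neq0. Qed.

Lemma gammafE : gammaf a b y = e * q ^+ 2.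
Proof.
rewrite /qf sqr_sqrtr //; move: ys; case: s => /= [[h _]|[_ h]].
  by rewrite gtr0_norm // mul1r.
by rewrite ltr0_norm // mulN1r opprK.
Qed.

Lemma BfE : B = e * q ^+ 2 - g * beta * q - beta ^+ 2.
Proof. by rewrite /Bf gammafE. Qed.

Lemma Bf_neq0 : B != 0.
Proof.
have := qf_gt0; have := BfE; move: ys; case: s => /= [[_ h]|[[g1 g2] _]] BE q0.
  by rewrite gt_eqF.
by rewrite lt_eqF // BE mulN1r spacelike_form_lt0.
Qed.

Lemma sector_slope_range : slope_range s g (beta / q).
Proof.
have := qf_gt0; have := BfE; move: ys; rewrite /slope_range; case: s => /= [[_ h]|[] //].
move=> BE q0; have -> : 1 - g * (beta / q) - (beta / q) ^+ 2 = B / q ^+ 2.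
  by rewrite BE; field; rewrite gt_eqF.
by rewrite divr_gt0 // exprn_gt0.
Qed.

(** In the space-like sector put x = g/(2h), u = L/(hb) and w = (t + g/2)/h. Then u - x = q/(hb) and
    w - x = b/(hq), whose product 1/h^2 is 1 + x^2; [atan_tan_pi2] then rewrites each branch with b
    nonzero, and b = 0 is immediate. *)
Lemma Jf_jfactor : Jf s a b g y = jfactor s g (beta / q).
Proof.
have q0 := qf_gt0; have qn : q != 0 by rewrite gt_eqF.
have := sector_slope_range; move: ys; rewrite /Jf /jfactor /slope_range.
case: s => /= [[gam0 B0] sr | [gB gam0] _].
  have [h1 h2] := timelike_factor_gt0 sr; congr (_ `^ _).
  field; rewrite qn !gt_eqF //=.
  by have := mulr_gt0 h2 q0; rewrite mulrBl divfK.
congr expR; have H : 0 < hconst Spacelike g by apply: hconst_gt0.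
have h0 : hconst Spacelike g != 0 by rewrite gt_eqF.
have := @hconst_sqr R Spacelike g; rewrite /= => /(_ (fun x => gB)) hs.
suff -> : ff Spacelike a b g y = - (pi / 2 + atan ((beta / q + g / 2) / hconst Spacelike g)).
  by field.
have G2 : Gconst Spacelike g / 2 = g / 2 / hconst Spacelike g by rewrite /Gconst; field.
rewrite /ff /Lf G2; case: ltP => [b0|]; last rewrite le_eqVlt => /orP[/eqP b0|b0].
(* For b < 0 the order of x and u is reversed, so all three arguments are negated. *)
- have := @atan_tan_pi2 R (- (g / 2 / hconst Spacelike g))
    (- ((qf a b y + g / 2 * beta) / (hconst Spacelike g * beta)))
    (- ((beta / q + g / 2) / hconst Spacelike g)).
  rewrite !atanN => key; rewrite -[LHS]opprK; congr (- _).
  rewrite -[atan ((_ / q + _) / _)]opprK key; first ring.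
    rewrite ltrN2 -subr_gt0.
    have -> : g / 2 / hconst Spacelike g - (q + g / 2 * beta) / (hconst Spacelike g * beta) = q / (hconst Spacelike g * - beta).
      by field; rewrite h0 lt_eqF.
    by rewrite divr_gt0 // mulr_gt0 // oppr_gt0.
  have bn : beta != 0 by rewrite lt_eqF.
  apply: (@mulIf _ (hconst Spacelike g ^+ 2)); first by rewrite expf_neq0.
  rewrite [RHS]mulrDl mul1r sqrrN expr_div_n divfK ?expf_neq0 // [in RHS]hs.
  by field; rewrite h0 bn qn.
- by rewrite -b0 ltxx mul0r add0r; ring.
- rewrite b0.
  have key := @atan_tan_pi2 R (g / 2 / hconst Spacelike g)
    ((qf a b y + g / 2 * beta) / (hconst Spacelike g * beta))
    ((beta / q + g / 2) / hconst Spacelike g).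
  rewrite key; first by field.
    rewrite -subr_gt0.
    have -> : (q + g / 2 * beta) / (hconst Spacelike g * beta) - g / 2 / hconst Spacelike g = q / (hconst Spacelike g * beta).
      by field; rewrite h0 gt_eqF.
    by rewrite divr_gt0 // mulr_gt0.
  have bn : beta != 0 by rewrite gt_eqF.
  apply: (@mulIf _ (hconst Spacelike g ^+ 2)); first by rewrite expf_neq0.
  rewrite [RHS]mulrDl mul1r expr_div_n divfK ?expf_neq0 // [in RHS]hs.
  by field; rewrite h0 bn qn.
Qed.

Lemma Jf_gt0 : 0 < Jf s a b g y.
Proof. by rewrite Jf_jfactor jfactor_gt0 //; exact: sector_slope_range. Qed.

End SectorPoint.

(** * The form r_ij, openness of the sectors, and the derivative of q *)

Section Derivatives.
Variables (R : realType) (N : nat) (s : sector).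
Variables (a : 'M[R]_N) (b : 'rV[R]_N) (g : R).
Hypothesis a_sym : a^T = a.
Implicit Types (z u v w : 'rV[R]_N).
Local Notation e := (eps R s).

Definition rbil u v : R := \sum_i \sum_j rform a b i j * u 0 i * v 0 j.

Lemma rform_sym i j : rform a b i j = rform a b j i.
Proof. by rewrite !mxE -[in a i j]a_sym mxE [b 0 i * _]mulrC. Qed.

Lemma rbilC u v : rbil u v = rbil v u.
Proof.
rewrite /rbil exchange_big; apply: eq_bigr => i _; apply: eq_bigr => j _.
by rewrite rform_sym mulrAC.
Qed.

Lemma rbilDZl t u v w : rbil (t *: u + v) w = t * rbil u w + rbil v w.
Proof.
rewrite /rbil mulr_sumr -big_split; apply: eq_bigr => i _ /=.
rewrite mulr_sumr -big_split; apply: eq_bigr => j _ /=.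
by rewrite !mxE; ring.
Qed.

Lemma rbilDZr t u v w : rbil w (t *: u + v) = t * rbil w u + rbil w v.
Proof. by rewrite rbilC rbilDZl ![rbil _ w]rbilC. Qed.

Lemma bscalDZ t u v : bscal b (t *: u + v) = t * bscal b u + bscal b v.
Proof.
rewrite /bscal mulr_sumr -big_split; apply: eq_bigr => i _ /=.
by rewrite !mxE; ring.
Qed.

Lemma gammaf_rbil z : gammaf a b z = rbil z z.
Proof. by []. Qed.

Lemma is_derive_bscal z v : is_derive z v (bscal b) (bscal b v).
Proof. by apply: (@is_derive_quadratic _ _ _ _ _ _ 0) => t; rewrite bscalDZ; ring. Qed.

Lemma is_derive_rbil u z v : is_derive z v (rbil^~ u) (rbil v u).
Proof. by apply: (@is_derive_quadratic _ _ _ _ _ _ 0) => t; rewrite rbilDZl; ring. Qed.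

Lemma is_derive_gammaf z v : is_derive z v (gammaf a b) (2 * rbil z v).
Proof.
apply: (@is_derive_quadratic _ _ _ _ _ _ (rbil v v)) => t.
by rewrite !gammaf_rbil rbilDZl !rbilDZr [rbil v z]rbilC; ring.
Qed.

Lemma continuous_sum_ord (n : nat) (f : 'I_n -> 'rV[R]_N -> R) :
  (forall i, continuous (f i)) -> continuous (fun z => \sum_(i < n) f i z).
Proof.
move=> fc; have addC : continuous (fun x : R * R => x.1 + x.2).
  exact: add_continuous.
apply: (@continuous_big R 'I_n +%R 0 xpredT addC _ (index_enum _) f) => i _.
exact: fc.
Qed.

Lemma continuous_mulf (f h : 'rV[R]_N -> R) :
  continuous f -> continuous h -> continuous (fun z => f z * h z).
Proof. by move=> fc hc z; apply: (@cvgM R _ (nbhs z) _ f h (f z) (h z)); [exact: fc | exact: hc]. Qed.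

Lemma continuous_subf (f h : 'rV[R]_N -> R) :
  continuous f -> continuous h -> continuous (fun z => f z - h z).
Proof. by move=> fc hc z; apply: (@cvgB R R _ (nbhs z) _ f h (f z) (h z)); [exact: fc | exact: hc]. Qed.

Lemma continuous_entry (i : 'I_N) : continuous (fun z : 'rV[R]_N => z 0 i).
Proof. by move=> z; exact: coord_continuous. Qed.

Lemma continuous_const (k : R) : continuous (fun _ : 'rV[R]_N => k).
Proof. exact: cst_continuous. Qed.

Lemma continuous_bscal : continuous (bscal b).
Proof.
apply: continuous_sum_ord => i.
exact: (@continuous_mulf (fun _ => b 0 i) (fun z => z 0 i) (@continuous_const _) (@continuous_entry i)).
Qed.

Lemma continuous_gammaf : continuous (gammaf a b).
Proof.
apply: continuous_sum_ord => i; apply: continuous_sum_ord => j.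
apply: (@continuous_mulf (fun z => rform a b i j * z 0 i) (fun z => z 0 j)).
  exact: (@continuous_mulf (fun _ => rform a b i j) (fun z => z 0 i)
    (@continuous_const _) (@continuous_entry i)).
exact: continuous_entry.
Qed.

Lemma continuous_qf : continuous (qf a b).
Proof.
move=> z; apply: (@continuous_comp _ _ _ (fun z => `|gammaf a b z|) (@Num.sqrt R)).
  apply: (@continuous_comp _ _ _ (gammaf a b) (fun x : R => `|x|)); first exact: continuous_gammaf.
  exact: norm_continuous.
exact: sqrt_continuous.
Qed.

Lemma continuous_Bf : continuous (Bf a b g).
Proof.
apply: (@continuous_subf (fun z => gammaf a b z - g * bscal b z * qf a b z)
  (fun z => bscal b z ^+ 2)).
  apply: (@continuous_subf _ (fun z => g * bscal b z * qf a b z)).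
    exact: continuous_gammaf.
  apply: (@continuous_mulf (fun z => g * bscal b z) _ _ continuous_qf).
  exact: (@continuous_mulf (fun=> g) _ (@continuous_const _) continuous_bscal).
exact: (@continuous_mulf (bscal b) (bscal b) continuous_bscal continuous_bscal).
Qed.

(** The closed forms hold only inside the sector; its openness turns them into equalities near z,
    which can be differentiated again. *)
Lemma near_in_sector z : in_sector s a b g z -> \forall x \near z, in_sector s a b g x.
Proof.
rewrite /in_sector; case: s => [[g0 B0] | [gB g0]].
  by near=> x; split; near: x; [apply: cvgr_gt g0 => //; exact: continuous_gammaf
    | apply: cvgr_gt B0; exact: continuous_Bf].
by near=> x; split => //; near: x; apply: cvgr_lt g0; exact: continuous_gammaf.
Unshelve. all: by end_near. Qed.

Lemma is_derive_qf z v : in_sector s a b g z ->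
  is_derive z v (qf a b) (e * rbil z v / qf a b z).
Proof.
move=> zs; have q0 := qf_gt0 zs; have g0 := gammaf_neq0 zs.
have ge : 0 < e * gammaf a b z.
  by rewrite (gammafE zs) mulrA eps_sqr mul1r exprn_gt0.
have sq : is_derive (e * gammaf a b z) 1 (@Num.sqrt R) (2 * Num.sqrt (e * gammaf a b z))^-1.
  exact: is_derive1_sqrt.
have qE : Num.sqrt (e * gammaf a b z) = qf a b z.
  by rewrite (gammafE zs) mulrA eps_sqr mul1r sqrtr_sqr gtr0_norm.
have D := is_derive_chain (is_derive_mulc e (is_derive_gammaf z v)) sq.
apply: near_eq_is_derive (is_derive_eq D _).
  near=> x; have xs : in_sector s a b g x by near: x; exact: near_in_sector.
  rewrite (gammafE xs) mulrA eps_sqr mul1r sqrtr_sqr gtr0_norm //.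
  exact: qf_gt0 xs.
by rewrite qE; field; rewrite gt_eqF.
Unshelve. all: by end_near. Qed.

End Derivatives.

(** * Closed forms of the Finsler tensors and their derivatives *)

Section Tensors.
Variables (R : realType) (N : nat) (s : sector).
Variables (a : 'M[R]_N) (b : 'rV[R]_N) (g : R).
Hypothesis a_sym : a^T = a.
Implicit Types (u v w z : 'rV[R]_N).
Local Notation e := (eps R s).
Local Notation beta := (bscal b).
Local Notation q := (qf a b).
Local Notation B := (Bf a b g).
Local Notation r := (rbil a b).
Local Notation sector_at := (in_sector s a b g).

Definition Jsq z : R := Jf s a b g z ^+ 2.
(** In a sector this is -q^2 times the differential of the slope b/q. Tensors are written as
    functions of vectors; components are their values on the basis rows. *)
Definition Af z u : R := e * beta z * r z u / q z - q z * beta u.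
Definition Hf z u v : R := r u v - e * r z u * r z v / q z ^+ 2.
Definition pf z u : R := g / (2 * B z) * Af z u.
Definition lowf z u : R := Jsq z * (r z u - (beta z + g * q z) * beta u).
Definition angf z u v : R := Jsq z * (Hf z u v - e / B z * Af z u * Af z v).
Definition metf z u v : R := angf z u v + lowf z u * lowf z v / F2 s a b g z.
(** For g nonzero the last term is lam p_u p_v p_w; in terms of A it has no division by g^2. *)
Definition cartf z u v w : R :=
  pf z w * angf z u v + pf z u * angf z v w + pf z v * angf z u w
  + Jsq z * e * g / (2 * B z ^+ 2) * Af z u * Af z v * Af z w.

Lemma eps_cases : e = 1 \/ e = -1.
Proof. by case: s; [left | right]. Qed.

Lemma Hf_sym z u v : Hf z u v = Hf z v u.
Proof. by rewrite /Hf rbilC //; ring. Qed.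

Lemma angf_sym z u v : angf z u v = angf z v u.
Proof. by rewrite /angf Hf_sym; ring. Qed.

Lemma metf_sym z u v : metf z u v = metf z v u.
Proof. by rewrite /metf angf_sym [lowf z u * _]mulrC. Qed.

Lemma cartf_sym12 z u v w : cartf z u v w = cartf z v u w.
Proof. by rewrite /cartf angf_sym; ring. Qed.

Section AtPoint.
Variable z : 'rV[R]_N.
Hypothesis zs : sector_at z.

Let q0 : q z != 0. Proof. by rewrite gt_eqF // (qf_gt0 zs). Qed.
Let B0 : B z != 0. Proof. exact: Bf_neq0 zs. Qed.
Let BE := BfE zs.
Let E0 : Jsq z != 0. Proof. by rewrite expf_neq0 // gt_eqF // (Jf_gt0 zs). Qed.

(** Splitting along v_i and A_i separates the radial part, fixed by homogeneity of degree two, from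
    a part that vanishes on z. *)
Lemma is_derive_Bf v :
  is_derive z v B (2 * e / q z ^+ 2 * B z * r z v + (g + 2 * beta z / q z) * Af z v).
Proof.
have Db := is_derive_bscal b z v; have Dq := is_derive_qf a_sym v zs.
have D := is_derive_subf (is_derive_subf (is_derive_gammaf b a_sym z v)
  (is_derive_mulf (is_derive_mulc g Db) Dq)) (is_derive_mulf Db Db).
apply: (is_derive_eq D); rewrite BE /Af.
by have [->|->] := eps_cases; field.
Qed.

Lemma is_derive_Af u v :
  is_derive z v (Af^~ u)
    (e * beta z / q z * Hf z u v + e / q z ^+ 2 * (r z v * Af z u - r z u * Af z v)).
Proof.
have Db := is_derive_bscal b z v; have Dq := is_derive_qf a_sym v zs.
have Dr := is_derive_rbil a b u z v.
have D := is_derive_subf (is_derive_divf q0 (is_derive_mulf (is_derive_mulc e Db) Dr) Dq)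
  (is_derive_mulf Dq (is_derive_const (beta u) z v)).
apply: (is_derive_eq D); rewrite /Af /Hf (rbilC _ a_sym v u).
by have [->|->] := eps_cases; field.
Qed.

Lemma is_derive_Hf u v w :
  is_derive z w (fun x => Hf x u v)
    (- (e / q z ^+ 2 * (Hf z u w * r z v + Hf z v w * r z u))).
Proof.
have Dq := is_derive_qf a_sym w zs.
have Du := is_derive_rbil a b u z w; have Dv := is_derive_rbil a b v z w.
have D := is_derive_subf (is_derive_const (r u v) z w)
  (is_derive_divf (g := fun x => q x * q x) (mulf_neq0 q0 q0) (is_derive_mulf (is_derive_mulc e Du) Dv)
    (is_derive_mulf Dq Dq)).
apply: (is_derive_eq D); rewrite /Af /Hf (rbilC _ a_sym w u) (rbilC _ a_sym w v).
by have [->|->] := eps_cases; field.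
Qed.

Lemma is_derive_Jsq v : is_derive z v Jsq (2 * pf z v * Jsq z).
Proof.
have sr := sector_slope_range zs.
have Dt := is_derive_divf q0 (is_derive_bscal b z v) (is_derive_qf a_sym v zs).
have Dj := is_derive_chain Dt (is_derive_jfactor sr).
have D := is_derive_mulf Dj Dj.
apply: near_eq_is_derive (is_derive_eq D _).
  near=> x; have xs : sector_at x by near: x; exact: near_in_sector.
  by rewrite /Jsq (Jf_jfactor xs).
rewrite /Jsq (Jf_jfactor zs) /pf /Af; set j := jfactor _ _ _; clearbody j.
have -> : e - g * (beta z / q z) - (beta z / q z) ^+ 2 = B z / q z ^+ 2.
  by rewrite BE; field.
by field; rewrite q0 B0.
Unshelve. all: by end_near. Qed.

Lemma is_derive_F2 v : is_derive z v (F2 s a b g) (2 * lowf z v).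
Proof.
have D := is_derive_mulf (is_derive_Bf v) (is_derive_Jsq v).
apply: (is_derive_eq D); rewrite /lowf /pf.
have -> : 2 * (g / (2 * B z) * Af z v) * Jsq z = g * Af z v * Jsq z / B z.
  by field.
rewrite [B z * _]mulrC divfK // [in 2 * e / _ * _ * _]BE /Af.
change (Jf s a b g z ^+ 2) with (Jsq z).
by have [->|->] := eps_cases; field.
Qed.

(** J cancels in y_i / F^2, leaving a rational combination of v_i and A_i, the same splitting as for
    the differential of B. *)
Lemma lowf_F2 u : lowf z u / F2 s a b g z = e * r z u / q z ^+ 2 + (beta z + g * q z) * Af z u / (q z * B z).
Proof.
rewrite /lowf /F2 -/(Jsq z) -[B z * _]mulrC -mulf_div divff // mul1r.
rewrite /Af; have := B0; rewrite BE => B1.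
(* With eps equal to 1 or -1, [field] asks that the expanded B be nonzero; the contraposition
   matches it with [B1] up to [ring]. *)
by have [ee|ee] := eps_cases; rewrite ee in B1 *; field;
  rewrite q0 ?andbT /=; apply: contraNneq B1 => BB; apply/eqP; rewrite -[RHS]BB; ring.
Qed.

Lemma is_derive_lowf u v : is_derive z v (lowf^~ u) (metf z u v).
Proof.
have Db := is_derive_bscal b z v; have Dq := is_derive_qf a_sym v zs.
have Dr := is_derive_rbil a b u z v.
have D := is_derive_mulf (is_derive_Jsq v) (is_derive_subf Dr
 (is_derive_mulf (is_derive_addf Db (is_derive_mulc g Dq)) (is_derive_const (beta u) z v))).
apply: (is_derive_eq D).
rewrite /metf -[_ * _ / F2 _ _ _ _ _]mulrA lowf_F2 /angf /lowf /pf /Hf /Af (rbilC _ a_sym v u).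
have := B0; rewrite BE => B1.
by have [ee|ee] := eps_cases; rewrite ee in B1 *; field;
  rewrite q0 ?andbT /=; apply: contraNneq B1 => BB; apply/eqP; rewrite -[RHS]BB; ring.
Qed.

End AtPoint.

Lemma is_derive_angf z u v w : sector_at z ->
  is_derive z w (fun x => angf x u v)
    (2 * pf z w * angf z u v - e / q z ^+ 2 * (r z v * angf z u w + r z u * angf z v w)
     - beta z / (q z * B z) * (angf z u w * Af z v + angf z v w * Af z u)
     + Jsq z * e * g / B z ^+ 2 * Af z u * Af z v * Af z w).
Proof.
move=> zs.
have q0 : q z != 0 by rewrite gt_eqF // (qf_gt0 zs).
have B0 : B z != 0 by exact: Bf_neq0 zs.
have DB := is_derive_Bf zs w.
have D := is_derive_mulf (is_derive_Jsq zs w) (is_derive_subf (is_derive_Hf zs u v w)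
 (is_derive_mulf (is_derive_mulf (is_derive_divf B0 (is_derive_const e z w) DB)
    (is_derive_Af zs u w)) (is_derive_Af zs v w))).
apply: (is_derive_eq D); rewrite /angf.
(* The derivatives are again expressed in H, A, r, J and p, so these values can be treated as
   independent unknowns. *)
set Hu := Hf z u w; set Hv := Hf z v w; set Hw := Hf z u v.
set Au := Af z u; set Av := Af z v; set Aw := Af z w.
move: (r z u) (r z v) (r z w) (Jsq z) (pf z w) => ru rv rw E p.
move: Hu Hv Hw Au Av Aw => Hu Hv Hw Au Av Aw.
by have [->|->] := eps_cases; field; rewrite q0 B0.
Qed.

Lemma is_derive_metf z u v w : sector_at z ->
  is_derive z w (fun x => metf x u v) (2 * cartf z u v w).
Proof.
move=> zs.
have q0 : q z != 0 by rewrite gt_eqF // (qf_gt0 zs).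
have B0 : B z != 0 by exact: Bf_neq0 zs.
have F0 : F2 s a b g z != 0 by rewrite mulf_neq0 // expf_neq0 // gt_eqF // (Jf_gt0 zs).
have D := is_derive_addf (is_derive_angf u v w zs) (is_derive_divf F0
  (is_derive_mulf (is_derive_lowf zs u w) (is_derive_lowf zs v w)) (is_derive_F2 zs w)).
apply: (is_derive_eq D).
(* On substituting g_ij = h_ij + y_i y_j / F^2, the purely radial terms cancel against the
   derivative of F^2. *)
have -> : ((metf z u w * lowf z v + lowf z u * metf z v w) * F2 s a b g z
   - lowf z u * lowf z v * (2 * lowf z w)) / F2 s a b g z ^+ 2
   = angf z u w * (lowf z v / F2 s a b g z) + (lowf z u / F2 s a b g z) * angf z v w.
  by rewrite /metf; field.
(* The terms with r and with b A / (q B) now cancel, and what remains is g A / B = 2 p. *)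
rewrite !lowf_F2 // /cartf /pf.
move: (angf z u w) (angf z v w) (angf z u v) (Jsq z) => h1 h2 h3 E.
by field; rewrite q0 B0.
Qed.

End Tensors.

(** * Determinants of low-rank perturbations, and bilinear forms *)

(** Sylvester's identity: [P *m M] and [M *m P] are block triangular, each with one identity
    diagonal block, and have equal determinants. *)
Lemma det_1DmulmxC (F : comUnitRingType) (m n : nat) (A : 'M[F]_(m, n)) (B : 'M[F]_(n, m)) :
  \det (1%:M + A *m B) = \det (1%:M + B *m A).
Proof.
pose M := block_mx 1%:M (- A) B 1%:M.
pose P := block_mx 1%:M 0 (- B) 1%:M.
have PM : P *m M = block_mx 1%:M (- A) 0 (1%:M + B *m A).
  rewrite /P /M mulmx_block !mul1mx !mul0mx !mulmx1 !addr0 addNr mulNmx mulmxN opprK.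
  by rewrite addrC.
have MP : M *m P = block_mx (1%:M + A *m B) (- A) 0 1%:M.
  by rewrite /P /M mulmx_block !mul1mx !mulmx1 !mulmx0 !add0r mulNmx mulmxN opprK subrr.
have : \det (P *m M) = \det (M *m P) by rewrite !det_mulmx mulrC.
by rewrite PM MP !det_ublock !det1 mul1r mulr1.
Qed.

Lemma det_block_scalar (F : comUnitRingType) (A B C D : 'M[F]_1) :
  \det (block_mx A B C D) = A 0 0 * D 0 0 - B 0 0 * C 0 0.
Proof.
rewrite (expand_det_row _ (lshift 1 0)) big_split_ord /= !big_ord1.
have minorE (i j : 'I_(1 + 1)) (M : 'M[F]_(1 + 1)) :
  row' i (col' j M) 0 0 = M (lift i 0) (lift j 0) by rewrite !mxE.
have l1 : lift (lshift 1 (ord0 : 'I_1)) (0 : 'I_1) = rshift 1 0 :> 'I_(1 + 1) by apply/val_inj.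
have l2 : lift (rshift 1 (ord0 : 'I_1)) (0 : 'I_1) = lshift 1 0 :> 'I_(1 + 1) by apply/val_inj.
rewrite block_mxEul block_mxEur /cofactor !det_mx11 !minorE l1 l2.
by rewrite block_mxEdr block_mxEdl /= expr0 expr1; ring.
Qed.

Section BilinearForm.
Variables (F : comUnitRingType) (N : nat).
Implicit Types (M : 'M[F]_N) (u v w : 'rV[F]_N).

Definition bilf M u v : F := (u *m M *m v^T) 0 0.

Lemma bilfDl M u v w : bilf M (u + v) w = bilf M u w + bilf M v w.
Proof. by rewrite /bilf !mulmxDl mxE. Qed.

Lemma bilfZl M k u v : bilf M (k *: u) v = k * bilf M u v.
Proof. by rewrite /bilf -!scalemxAl mxE. Qed.

Lemma bilfDr M u v w : bilf M u (v + w) = bilf M u v + bilf M u w.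
Proof. by rewrite /bilf linearD mulmxDr mxE. Qed.

Lemma bilfZr M k u v : bilf M u (k *: v) = k * bilf M u v.
Proof. by rewrite /bilf linearZ -scalemxAr mxE. Qed.

Lemma bilfC M u v : M^T = M -> bilf M u v = bilf M v u.
Proof. by move=> Ms; rewrite /bilf -[u *m M *m v^T]trmxK [LHS]mxE !trmx_mul trmxK Ms mulmxA. Qed.

Lemma bilf_sum M u v : bilf M u v = \sum_i \sum_j M i j * u 0 i * v 0 j.
Proof.
rewrite /bilf mxE exchange_big; apply: eq_bigr => j _.
rewrite !mxE mulr_suml; apply: eq_bigr => i _.
by rewrite [u 0 i * _]mulrC.
Qed.

Lemma bilf_delta M i j : bilf M (delta_mx 0 i) (delta_mx 0 j) = M i j.
Proof. by rewrite /bilf -rowE trmx_delta -colE !mxE. Qed.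

Lemma linear_rowE (f : 'rV[F]_N -> F) :
  (forall k u v, f (k *: u + v) = k * f u + f v) ->
  forall u, (u *m (\row_k f (delta_mx 0 k))^T) 0 0 = f u.
Proof.
move=> fl u; have f0 : f 0 = 0.
  by have := fl (-1) 0 0; rewrite scaler0 addr0 mulN1r addNr.
rewrite [in RHS](row_sum_delta u) mxE.
symmetry; apply: (big_ind2 (fun x y => f x = y)) => //.
  by move=> x1 x2 y1 y2 <- <-; rewrite -[x1 in LHS]scale1r fl mul1r.
by move=> i _; rewrite -[_ *: _]addr0 fl f0 addr0 !mxE.
Qed.

Lemma bilf_unique M (f : 'rV[F]_N -> 'rV[F]_N -> F) :
  (forall k u v w, f (k *: u + v) w = k * f u w + f v w) ->
  (forall k u v w, f w (k *: u + v) = k * f w u + f w v) ->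
  (forall i j, f (delta_mx 0 i) (delta_mx 0 j) = M i j) ->
  forall u v, f u v = bilf M u v.
Proof.
move=> fl fr fM u v; rewrite bilf_sum -(linear_rowE (f := f^~ v)) //.
rewrite mxE; apply: eq_bigr => i _; rewrite !mxE -(linear_rowE (f := f (delta_mx 0 i))) // mxE mulr_sumr.
by apply: eq_bigr => j _; rewrite !mxE fM; ring.
Qed.

(* hi, hj, hm, hn are rows of h, and C u v is the row k |-> C_kuv of the tensor
   C_kuv = p_k h_uv + p_u h_kv + p_v h_ku + lam p_k p_u p_v. *)
Lemma cubic_contraction M (hi hj hm hn p : 'rV[F]_N)
    (pi_ pj pm pn him hin hjm hjn hij hmn P lam : F) :
  M^T = M ->
  bilf M hi p = pi_ -> bilf M hj p = pj -> bilf M hm p = pm -> bilf M hn p = pn ->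
  bilf M hi hm = him -> bilf M hi hn = hin -> bilf M hj hm = hjm -> bilf M hj hn = hjn ->
  bilf M hi hj = hij -> bilf M hm hn = hmn -> bilf M p p = P ->
  let C u v (pu pv huv : F) := pu *: v + pv *: u + (huv + lam * pu * pv) *: p in
  bilf M (C hj hm pj pm hjm) (C hi hn pi_ pn hin)
    - bilf M (C hj hn pj pn hjn) (C hi hm pi_ pm him)
  = - P * (him * hjn - hin * hjm)
    - (1 + lam * P) * (pi_ * pm * hjn - pi_ * pn * hjm + pj * pn * him - pj * pm * hin).
Proof.
move=> Ms; have Mc := bilfC _ _ Ms.
move=> hip hjp hmp hnp e1 e2 e3 e4 e5 e6 eP C; rewrite /C.
rewrite !(bilfDl, bilfZl, bilfDr, bilfZr).
rewrite ?(Mc p hi) ?(Mc p hj) ?(Mc p hm) ?(Mc p hn) ?(Mc hm hi) ?(Mc hn hi) ?(Mc hm hj)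
  ?(Mc hn hj) ?(Mc hj hi) ?(Mc hn hm).
by rewrite hip hjp hmp hnp e1 e2 e3 e4 e5 e6 eP; ring.
Qed.

End BilinearForm.

(** * Derivatives for the logarithm of the metric determinant *)

(** The sign is constant near a nonzero x, so there the norm is multiplication by [Num.sg x]. *)
Lemma is_derive_ln_sqrt_norm (R : realType) (x : R) : x != 0 ->
  is_derive x 1 (fun t => ln (Num.sqrt `|t|)) (2 * x)^-1.
Proof.
move=> x0; have nx : 0 < Num.sg x * x by rewrite -normrEsg normr_gt0.
have D1 := is_derive_mulc (Num.sg x) (is_derive_id x 1).
have D2 := is_derive_chain D1 (is_derive1_sqrt nx).
have s0 : 0 < Num.sqrt (Num.sg x * x) by rewrite sqrtr_gt0.
have D3 := is_derive_chain D2 (is_derive1_ln s0).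
apply: near_eq_is_derive (is_derive_eq D3 _).
  have := x0; rewrite neq_lt => /orP[xn|xp].
    near=> t; have tn : t < 0 by near: t; exact: lt_nbhsl.
    by rewrite ltr0_sg // mulN1r ltr0_norm.
  near=> t; have tn : 0 < t by near: t; exact: lt_nbhsr.
  by rewrite gtr0_sg // mul1r gtr0_norm.
have h : (Num.sqrt (Num.sg x * x)) ^+ 2 = Num.sg x * x by rewrite sqr_sqrtr // ltW.
set S := Num.sqrt _ in s0 h *.
have S0 : S != 0 by rewrite gt_eqF.
have sg0 : Num.sg x != 0 by rewrite sgr_eq0.
have -> : (2 * x)^-1 = Num.sg x / (2 * S ^+ 2) by rewrite h; field; rewrite x0 sg0.
by rewrite mulr1; field.
Unshelve. all: by end_near. Qed.

(** The logarithmic derivative l keeps the exponent n on both sides and avoids n - 1, so n = 0 fits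
    too. *)
Lemma is_derive_expf (R : realType) (V : normedModType R) (f : V -> R) (n : nat) (z v : V) (l : R) :
  is_derive z v f (l * f z) -> is_derive z v (fun x => f x ^+ n) (n%:R * l * f z ^+ n).
Proof.
move=> Df; elim: n => [|n IH].
  by apply: (is_derive_eq (is_derive_const 1 z v)); rewrite !mul0r.
rewrite (_ : (fun x => _) = fun x => f x * f x ^+ n); last by apply/funext => x; rewrite exprS.
by apply: (is_derive_eq (is_derive_mulf Df IH)); rewrite exprS -natr1; ring.
Qed.

(** * Identification of the Finsler tensors with the closed forms, and the determinant of g_ij *)

Section Geometry.
Variables (R : realType) (N : nat) (s : sector).
Variables (a : 'M[R]_N) (b : 'rV[R]_N) (g c : R).
Hypothesis a_sym : a^T = a.
Hypothesis a_unit : a \in unitmx.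
Hypothesis b_norm : form_sqnorm a b = - c ^+ 2.
Implicit Types (u v w z : 'rV[R]_N).
Local Notation e := (eps R s).
Local Notation beta := (bscal b).
Local Notation q := (qf a b).
Local Notation B := (Bf a b g).
Local Notation r := (rbil a b).
Local Notation sector_at := (in_sector s a b g).
Local Notation d_ i := (delta_mx 0 i : 'rV[R]_N).
Local Notation kap := (1 - c ^+ 2).
Local Notation E_ := (Jsq s a b g).
Local Notation A_ := (Af s a b).
Local Notation p_ := (pf s a b g).
Local Notation low := (lowf s a b g).
Local Notation ang := (angf s a b g).
Local Notation met := (metf s a b g).
Local Notation cart := (cartf s a b g).
Local Notation nu := (nuf s a b g c).

Lemma pderiv_F2 i z : sector_at z -> pderiv i (F2 s a b g) z = 2 * low z (d_ i).
Proof. by move=> zs; have D := is_derive_F2 a_sym zs (d_ i); exact: derive_val. Qed.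

Lemma ylowE i z : sector_at z -> ylow s a b g i z = low z (d_ i).
Proof. by move=> zs; rewrite /ylow pderiv_F2 // mulrC mulKf // pnatr_eq0. Qed.

Lemma gmetE z i j : sector_at z -> gmet s a b g z i j = met z (d_ i) (d_ j).
Proof.
move=> zs; rewrite mxE.
have D := is_derive_mulc 2 (is_derive_lowf a_sym zs (d_ i) (d_ j)).
have -> : pderiv j (pderiv i (F2 s a b g)) z = 2 * met z (d_ i) (d_ j).
  rewrite /pderiv; rewrite -[RHS](@derive_val _ _ _ _ _ _ _ D).
  apply: near_eq_derive; near=> x; have xs : sector_at x by near: x; exact: near_in_sector.
  exact: pderiv_F2.
by rewrite mulrC mulKf // pnatr_eq0.
Unshelve. all: by end_near. Qed.

Lemma CtensE i j k z : sector_at z -> Ctens s a b g i j k z = cart z (d_ i) (d_ j) (d_ k).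
Proof.
move=> zs; rewrite /Ctens.
have D := is_derive_metf a_sym (d_ i) (d_ j) (d_ k) zs.
have -> : pderiv k (fun z => gmet s a b g z i j) z = 2 * cart z (d_ i) (d_ j) (d_ k).
  rewrite /pderiv; rewrite -[RHS](@derive_val _ _ _ _ _ _ _ D).
  apply: near_eq_derive; near=> x; have xs : sector_at x by near: x; exact: near_in_sector.
  exact: gmetE.
by rewrite mulrC mulKf // pnatr_eq0.
Unshelve. all: by end_near. Qed.

Lemma hangE i j z : sector_at z -> hang s a b g i j z = ang z (d_ i) (d_ j).
Proof. by move=> zs; rewrite /hang gmetE // !ylowE // /metf addrK. Qed.

Lemma rbil_bilf u v : r u v = bilf a u v + beta u * beta v.
Proof.
rewrite bilf_sum /rbil /bscal mulr_suml -big_split; apply: eq_bigr => i _ /=.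
rewrite mulr_sumr -big_split; apply: eq_bigr => j _ /=.
by rewrite mxE; ring.
Qed.

Lemma bscal_row u : beta u = (u *m b^T) 0 0.
Proof. by rewrite mxE; apply: eq_bigr => i _; rewrite mxE mulrC. Qed.

(** The vector a^{ij} b_j, on which b takes the value -c^2. *)
Definition beta_up : 'rV[R]_N := b *m invmx a.

Lemma bilf_beta_up u : bilf a beta_up u = beta u.
Proof.
by rewrite /bilf /beta_up mulmxKV // mxE; apply: eq_bigr => i _; rewrite mxE.
Qed.

Lemma bscal_beta_up : beta beta_up = - c ^+ 2.
Proof.
rewrite -b_norm bscal_row /beta_up -/(bilf (invmx a) b b) bilf_sum.
by [].
Qed.

Lemma rbil_beta_up z : r z beta_up = kap * beta z.
Proof. by rewrite rbil_bilf bilfC // bilf_beta_up bscal_beta_up; ring. Qed.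

Section AtPoint.
Variable z : 'rV[R]_N.
Hypothesis zs : sector_at z.

Let q0 : q z != 0. Proof. by rewrite gt_eqF // (qf_gt0 zs). Qed.
Let B0 : B z != 0. Proof. exact: Bf_neq0 zs. Qed.
Let BE := BfE zs.
Let E0 : E_ z != 0. Proof. by rewrite expf_neq0 // gt_eqF // (Jf_gt0 zs). Qed.
Let F0 : F2 s a b g z != 0. Proof. exact: mulf_neq0 B0 E0. Qed.
Let rzz : r z z = e * q z ^+ 2. Proof. by rewrite -gammaf_rbil (gammafE zs). Qed.

(** Up to the factor J^2, the metric is a plus a form built from v and b alone, the rank-two shape
    that the determinant needs. *)
Lemma met_bilf u v : met z u v = E_ z * (bilf a u v + g / B z *
  ((e * beta z / q z) * r z u * r z v - q z * (r z u * beta v + beta u * r z v)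
   + q z * (beta z + g * q z) * beta u * beta v)).
Proof.
rewrite /metf -[_ * _ / F2 _ _ _ _ _]mulrA lowf_F2 // /angf /lowf /Hf /Af rbil_bilf.
have := B0; rewrite BE => B1.
have [ee|ee] := eps_cases R s; rewrite ee in B1 *; field;
  rewrite q0 ?andbT /=; apply: contraNneq B1 => BB; apply/eqP; rewrite -[RHS]BB; ring.
Qed.

(** Homogeneity: the radial direction z is killed by A, p and h, and g sends it to y_i. Raising the
    index of h relies on these relations. *)
Lemma Af_self : A_ z z = 0.
Proof. by rewrite /Af rzz mulrAC -mulrA; have [->|->] := eps_cases R s; field. Qed.

Lemma pf_self : p_ z z = 0.
Proof. by rewrite /pf Af_self mulr0. Qed.

Lemma angf_self v : ang z z v = 0.
Proof.
by rewrite /angf Af_self /Hf rzz; have [->|->] := eps_cases R s; field; rewrite q0 B0.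
Qed.

Lemma lowf_self : low z z = F2 s a b g z.
Proof. by rewrite /lowf rzz /F2 BE -/(E_ z); ring. Qed.

Lemma metf_self v : met z z v = low z v.
Proof. by rewrite /metf angf_self lowf_self add0r mulrAC divff // mul1r. Qed.

Lemma Af_DZ k u v : A_ z (k *: u + v) = k * A_ z u + A_ z v.
Proof. by rewrite /Af rbilDZr // bscalDZ; field. Qed.

Lemma pf_DZ k u v : p_ z (k *: u + v) = k * p_ z u + p_ z v.
Proof. by rewrite /pf Af_DZ; ring. Qed.

Lemma lowf_DZ k u v : low z (k *: u + v) = k * low z u + low z v.
Proof. by rewrite /lowf rbilDZr // bscalDZ; ring. Qed.

Lemma angf_DZr k u v w : ang z w (k *: u + v) = k * ang z w u + ang z w v.
Proof. by rewrite /angf /Hf Af_DZ !rbilDZr //; field; rewrite B0 q0. Qed.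

Lemma metf_DZr k u v w : met z w (k *: u + v) = k * met z w u + met z w v.
Proof. by rewrite /metf angf_DZr lowf_DZ; field. Qed.

(** The raised b is sent by h to a multiple of A, hence, when nu is nonzero, p is an h-row. This
    gives p_i p^i without an explicit inverse of g. *)
Lemma angf_beta_up v : ang z beta_up v = - (E_ z * e * nu z / B z) * A_ z v.
Proof.
rewrite /angf /nuf /Hf /Af rbil_beta_up bscal_beta_up [r beta_up v]rbilC // rbil_beta_up.
have := B0; rewrite BE => B1.
have [ee|ee] := eps_cases R s; rewrite ee in B1 *; field;
  rewrite q0 ?andbT /=; apply: contraNneq B1 => BB; apply/eqP; rewrite -[RHS]BB; ring.
Qed.

Lemma Af_beta_up : A_ z beta_up = nu z - e * kap * B z / q z.
Proof.
rewrite /Af /nuf rbil_beta_up bscal_beta_up BE.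
by have [->|->] := eps_cases R s; field.
Qed.

Local Notation G := (gmet s a b g z).
Let iG := invmx G.

Lemma gmet_sym : G^T = G.
Proof. by apply/matrixP => i j; rewrite mxE !gmetE // metf_sym. Qed.

Lemma metf_gmet u v : met z u v = bilf G u v.
Proof.
apply: bilf_unique => [k u1 v1 w|k u1 v1 w|i j]; last by rewrite gmetE.
  by rewrite metf_sym // metf_DZr ![met z w _]metf_sym.
exact: metf_DZr.
Qed.

Lemma bscal_delta i : beta (d_ i) = b 0 i.
Proof.
rewrite /bscal (bigD1 i) //= big1 ?addr0 => [|j ji].
  by rewrite mxE !eqxx mulr1.
by rewrite mxE (negPf ji) andbF mulr0.
Qed.

Lemma bilf_mulmxV u v : bilf (invmx a) (u *m a) v = (u *m v^T) 0 0.
Proof. by rewrite /bilf mulmxK. Qed.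

Lemma det_gmet : \det G = \det a * (E_ z ^+ N * (1 - e * kap * g * (beta z / q z))).
Proof.
have [v vdef] : exists v, v = z *m a + beta z *: b by eexists.
have vE i : v 0 i = r z (d_ i).
  by rewrite vdef rbil_bilf bscal_delta /bilf trmx_delta -colE !mxE.
(* [t1] and [t2] collect the coefficients of v_i and b_i in [met_bilf], so the perturbation is v^T
   t1 + b^T t2 and Sylvester's identity leaves a 2 by 2 determinant. *)
pose t1 := g / B z *: ((e * beta z / q z) *: v + (- q z) *: b).
pose t2 := g / B z *: (- q z *: v + (q z * (beta z + g * q z)) *: b).
pose L := row_mx v^T b^T; pose T := col_mx t1 t2.
have GE : G = E_ z *: (a + L *m T).
  apply/matrixP => i j; rewrite gmetE // met_bilf bilf_delta -!vE !bscal_delta.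
  rewrite /L /T mul_row_col /t1 /t2.
  by rewrite !mxE !big_ord1 !mxE; ring.
have -> : G = E_ z *: (a *m (1%:M + invmx a *m L *m T)).
  by rewrite GE mulmxDr mulmx1 -mulmxA mulKVmx.
rewrite detZ det_mulmx det_1DmulmxC /T /L.
rewrite [_ *m row_mx _ _]mul_mx_row mul_col_row.
rewrite [1%:M](@scalar_mx_block _ 1 1) add_block_mx !add0r det_block_scalar.
have entry x w k : (k%:M + x *m (invmx a *m w^T)) 0 0 = k + bilf (invmx a) x w.
  by rewrite /bilf mulmxA mxE [k%:M 0 0]mxE eqxx mulr1n.
have entry0 x w : (x *m (invmx a *m w^T)) 0 0 = bilf (invmx a) x w.
  by rewrite /bilf mulmxA.
have iaC x w : bilf (invmx a) x w = bilf (invmx a) w x.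
  by apply: bilfC; rewrite trmx_inv a_sym.
have bb : bilf (invmx a) b b = - c ^+ 2 by rewrite bilf_sum -b_norm.
have vb : bilf (invmx a) v b = kap * beta z.
  by rewrite vdef bilfDl bilfZl bilf_mulmxV -bscal_row bb; ring.
have vv : bilf (invmx a) v v = e * q z ^+ 2 + kap * beta z ^+ 2.
  rewrite {2}vdef bilfDr bilfZr vb iaC bilf_mulmxV.
  have -> : (z *m v^T) 0 0 = r z z.
    have addE (x w : 'M[R]_1) : (x + w) 0 0 = x 0 0 + w 0 0 by rewrite mxE.
    have scaleE k (x : 'M[R]_1) : (k *: x) 0 0 = k * x 0 0 by rewrite mxE.
    rewrite vdef linearD linearZ /= mulmxDr -scalemxAr addE scaleE -bscal_row.
    by rewrite rbil_bilf /bilf trmx_mul a_sym mulmxA.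
  by rewrite rzz; ring.
rewrite !entry !entry0 /t1 /t2 !(bilfDl, bilfZl) (iaC b v) vb vv bb.
rewrite mulrCA; congr (_ * (_ * _)).
have := B0; rewrite BE => B1.
have [ee|ee] := eps_cases R s; rewrite ee in B1 *; field;
  rewrite q0 ?andbT /=; apply: contraNneq B1 => BB; apply/eqP; rewrite -[RHS]BB; ring.
Qed.

End AtPoint.

Lemma qf_neq0 z : sector_at z -> q z != 0.
Proof. by move=> zs; rewrite gt_eqF // (qf_gt0 zs). Qed.

Lemma det_factor_nu z : sector_at z -> 1 - e * kap * g * (beta z / q z) = nu z / q z.
Proof. by move=> zs; rewrite /nuf; field; exact: qf_neq0. Qed.

(** In the logarithm of the determinant J^(2N) contributes N p, and nu / q, an affine function of
    the slope, contributes the remaining multiple of p. *)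
Lemma CvecE i z : sector_at z -> nu z != 0 ->
  Cvec s a b g i z = Xinv s a b g c z * p_ z (d_ i).
Proof.
move=> zs nu0; have q0 := qf_neq0 zs; have B0 := Bf_neq0 zs.
have DE := is_derive_Jsq a_sym zs (d_ i).
have Dt := is_derive_subf (is_derive_const 1 z (d_ i)) (is_derive_mulc (e * kap * g)
  (is_derive_divf q0 (is_derive_bscal b z (d_ i)) (is_derive_qf a_sym (d_ i) zs))).
have DD := is_derive_mulc (\det a) (is_derive_mulf (is_derive_expf N DE) Dt).
have Dn0 : \det a * (E_ z ^+ N * (1 - e * kap * g * (beta z / q z))) != 0.
  rewrite det_factor_nu // !mulf_neq0 ?invr_neq0 //.
    by rewrite -unitfE -unitmxE.
  by rewrite expf_neq0 // expf_neq0 // gt_eqF // (Jf_gt0 zs).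
have D := is_derive_chain DD (is_derive_ln_sqrt_norm Dn0).
rewrite /Cvec /pderiv.
transitivity ('D_(d_ i) (fun x => ln (Num.sqrt `|\det a * (E_ x ^+ N * (1 - e * kap * g * (beta x / q x)))|)) z).
  apply: near_eq_derive; near=> x; have xs : sector_at x by near: x; exact: near_in_sector.
  by rewrite det_gmet.
rewrite derive_val /Xinv /pf /Af; move: Dn0; rewrite det_factor_nu // => Dn0.
have E0 : E_ z ^+ N != 0 by apply: contraNneq Dn0 => ->; rewrite mul0r mulr0.
have d0 : \det a != 0 by apply: contraNneq Dn0 => ->; rewrite mul0r.
move: (E_ z ^+ N) (\det a) E0 d0 => EN da E0 d0.
by field; rewrite E0 d0 nu0 q0 B0.
Unshelve. all: by end_near. Qed.

(** * Contractions with the inverse metric, and the curvature *)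

Section Contraction.
Variable z : 'rV[R]_N.
Hypotheses (zs : sector_at z) (nu0 : nu z != 0).
Local Notation G := (gmet s a b g z).
Local Notation dotG := (bilf (invmx G)).

Let q0 : q z != 0. Proof. exact: qf_neq0. Qed.
Let B0 : B z != 0. Proof. exact: Bf_neq0 zs. Qed.
Let E0 : E_ z != 0. Proof. by rewrite expf_neq0 // gt_eqF // (Jf_gt0 zs). Qed.

Lemma gmet_unit : G \in unitmx.
Proof.
have d0 : \det a != 0 by rewrite -unitfE -unitmxE.
rewrite unitmxE det_gmet // det_factor_nu // unitfE mulf_neq0 //.
by apply: mulf_neq0; [exact: expf_neq0 | exact: mulf_neq0 (invr_neq0 _)].
Qed.

Definition ang_row u : 'rV[R]_N := \row_k ang z u (d_ k).
Definition p_row : 'rV[R]_N := \row_k p_ z (d_ k).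

(** Raising one index of h projects u along z: the result is u - (y(u) / F^2) z. *)
Lemma ang_row_gmet u : ang_row u = (- (low z u / F2 s a b g z) *: z + u) *m G.
Proof.
apply/rowP => k; rewrite mxE; set u' := (_ + u).
have -> : (u' *m G) 0 k = bilf G u' (d_ k) by rewrite /bilf trmx_delta -colE [RHS]mxE.
rewrite -metf_gmet // metf_sym // metf_DZr // ![met z (d_ k) _]metf_sym // metf_self //.
by rewrite /metf; ring.
Qed.

(** The projection differs from u by a multiple of z, so a linear form vanishing on z takes the same
    value on both. *)
Lemma dotG_ang_row u (f : 'rV[R]_N -> R) :
  (forall k v w, f (k *: v + w) = k * f v + f w) -> f z = 0 ->
  dotG (ang_row u) (\row_k f (d_ k)) = f u.
Proof.
move=> fl fz; rewrite ang_row_gmet /bilf (mulmxK gmet_unit).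
by rewrite linear_rowE // fl fz mulr0 add0r.
Qed.

Lemma dotG_ang u v : dotG (ang_row u) (ang_row v) = ang z u v.
Proof.
rewrite (@dotG_ang_row u (ang z v)); first exact: angf_sym.
  by move=> k v1 w; exact: angf_DZr.
by rewrite angf_sym // angf_self.
Qed.

Lemma dotG_p u : dotG (ang_row u) p_row = p_ z u.
Proof.
rewrite dotG_ang_row //; last exact: pf_self.
by move=> k v w; exact: pf_DZ.
Qed.

Lemma p_row_beta_up : p_row = - (g * e / (2 * E_ z * nu z)) *: ang_row beta_up.
Proof.
apply/rowP => k; rewrite !mxE angf_beta_up // /pf; move: (A_ z _) => A.
by have [->|->] := eps_cases R s; field; rewrite B0 nu0 E0.
Qed.

(** Writing one copy of p as an h-row reduces the contraction to evaluating the other copy at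
    [beta_up]. *)
Lemma dotG_pp : dotG p_row p_row
  = - (g ^+ 2 * e / (4 * E_ z * nu z * B z)) * (nu z - e * kap * B z / q z).
Proof.
rewrite {1}p_row_beta_up bilfZl dotG_p /pf Af_beta_up //.
by field; rewrite q0 B0 nu0 E0.
Qed.

(** At g = 0 the division gives 0; the decomposition of the Cartan tensor is used for g nonzero. *)
Definition lam := 4 * e * B z * E_ z / g ^+ 2.

(** The right-hand side is 1/X - N, the source of the second coefficient in the curvature
    formula. *)
Lemma lam_dotG_pp : g != 0 -> 1 + lam * dotG p_row p_row = e * kap * B z / (q z * nu z).
Proof.
move=> g0; rewrite dotG_pp /lam.
by have [->|->] := eps_cases R s; field; rewrite q0 B0 nu0 E0 g0.
Qed.

Lemma cart_row v w : g != 0 -> \row_k cart z (d_ k) v w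
  = p_ z v *: ang_row w + p_ z w *: ang_row v + (ang z v w + lam * p_ z v * p_ z w) *: p_row.
Proof.
move=> g0; apply/rowP => k; rewrite !mxE /cartf [ang z (d_ k) v]angf_sym // [ang z (d_ k) w]angf_sym //.
rewrite /lam /pf; move: (ang _ _ _) (ang _ _ _) (ang _ _ _) => h1 h2 h3.
by field; rewrite g0 B0.
Qed.

Lemma dotG_sum u v : dotG u v = \sum_h u 0 h * \sum_l invmx G h l * v 0 l.
Proof.
rewrite bilf_sum; apply: eq_bigr => h _; rewrite mulr_sumr; apply: eq_bigr => l _.
by ring.
Qed.

Lemma Csq_dotG : Csq s a b g z = Xinv s a b g c z ^+ 2 * dotG p_row p_row.
Proof.
rewrite dotG_sum mulr_sumr; apply: eq_bigr => h _; rewrite /Cvec_up CvecE // mxE !mulr_sumr.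
by apply: eq_bigr => l _; rewrite CvecE // mxE /ginv; ring.
Qed.

Lemma gmet_Cmix h j m :
  \sum_k G j k * Cmix s a b g h k m z = cart z (d_ h) (d_ j) (d_ m).
Proof.
pose T := \col_l Ctens s a b g h l m z.
have -> : \sum_k G j k * Cmix s a b g h k m z = (G *m (invmx G *m T)) j 0.
  rewrite [RHS]mxE; apply: eq_bigr => k _; rewrite [(invmx G *m T) k 0]mxE.
  by congr (_ * _); apply: eq_bigr => l _; rewrite [T l 0]mxE.
by rewrite mulKVmx ?gmet_unit // mxE CtensE.
Qed.

(** Lowering j turns the first factor of each product into C_hjm; the index h raised in the other
    factor is then the pairing by the inverse metric. *)
Lemma Rhat_lowE i j m n : Rhat_low s a b g i j m n z =
  dotG (\row_k cart z (d_ k) (d_ j) (d_ m)) (\row_k cart z (d_ k) (d_ i) (d_ n))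
  - dotG (\row_k cart z (d_ k) (d_ j) (d_ n)) (\row_k cart z (d_ k) (d_ i) (d_ m)).
Proof.
have dotE m' n' : dotG (\row_k cart z (d_ k) (d_ j) (d_ m')) (\row_k cart z (d_ k) (d_ i) (d_ n'))
    = \sum_h \sum_k G j k * (Cmix s a b g h k m' z * Cmix s a b g i h n' z).
  rewrite dotG_sum; apply: eq_bigr => h _.
  rewrite [(\row_k _) 0 h]mxE -(gmet_Cmix h j m') mulr_suml.
  apply: eq_bigr => k _; rewrite -mulrA; congr (_ * (_ * _)).
  apply: eq_bigr => l _; rewrite [(\row_k _) 0 l]mxE CtensE //.
  by rewrite cartf_sym12.
rewrite !dotE /Rhat_low /Rhat; under eq_bigr => k _ do rewrite mulr_sumr.
rewrite exchange_big /= -sumrB; apply: eq_bigr => h _.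
by rewrite -sumrB; apply: eq_bigr => k _; rewrite mulrBr.
Qed.

End Contraction.

Theorem indicatrix_curvature z (i j m n : 'I_N) :
  sector_at z -> nu z != 0 -> Csq s a b g z != 0 ->
  let X := Xf s a b g c z in
  let CC := Csq s a b g z in
  let C k := Cvec s a b g k z in
  let h k l := hang s a b g k l z in
  Rhat_low s a b g i j m n z =
    - CC * X ^+ 2 * (h i m * h j n - h i n * h j m)
    + X ^+ 2 * (N%:R - X^-1)
      * (C i * C m * h j n - C i * C n * h j m
         + C j * C n * h i m - C j * C m * h i n).
Proof.
move=> zs nu0 CC0 /=.
have := CC0; rewrite Csq_dotG // mulf_eq0 negb_or expf_eq0 /= => /andP[Xi0 P0].
(* C_h C^h = p_h p^h / X^2, and p_h p^h has a factor g^2, so g = 0 is excluded. *)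
have g0 : g != 0.
  by apply: contraNneq P0 => g0; rewrite dotG_pp // g0 expr0n /= !mul0r oppr0 mul0r.
rewrite Rhat_lowE // !cart_row // /Xf invrK !CvecE // !hangE //.
have Gs : (invmx (gmet s a b g z))^T = invmx (gmet s a b g z) by rewrite trmx_inv gmet_sym.
rewrite (cubic_contraction (lam z) Gs (dotG_p zs nu0 (d_ i)) (dotG_p zs nu0 (d_ j))
  (dotG_p zs nu0 (d_ m)) (dotG_p zs nu0 (d_ n)) (dotG_ang zs nu0 _ _) (dotG_ang zs nu0 _ _)
  (dotG_ang zs nu0 _ _) (dotG_ang zs nu0 _ _) (dotG_ang zs nu0 _ _) (dotG_ang zs nu0 _ _) erefl).
rewrite lam_dotG_pp //.
(* It remains to substitute C_i = p_i / X: X^2 C_i C_j is p_i p_j and X^2 C_h C^h is p_h p^h. *)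
have -> : e * kap * B z / (q z * nu z) = Xinv s a b g c z - N%:R.
  by rewrite /Xinv [N%:R + _]addrC addrK !mulrA.
by field.
Qed.

End Geometry.

(** * From one tangent space to the fields on a chart *)

Lemma lorentzian_unitmx (R : realType) (N : nat) (a : 'M[R]_N) :
  lorentzian a -> a \in unitmx.
Proof.
case=> _ [P _ PaP]; have : P *m a *m P^T \in unitmx.
  rewrite PaP unitmxE det_diag unitfE; apply/prodf_neq0 => i _.
  by rewrite mxE; case: ifP; rewrite ?oppr_eq0 oner_neq0.
by rewrite !unitmx_mul => /andP[/andP[]].
Qed.

Unset Implicit Arguments.

Theorem mainTheorem6 (R : realType) (N : nat) (U : set 'rV[R]_N)
    (a : 'rV[R]_N -> 'M[R]_N) (b : 'rV[R]_N -> 'rV[R]_N)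
    (c g : 'rV[R]_N -> R) (s : sector)
    (U_open : open U)
    (a_smooth : forall i j : 'I_N, smooth_on U (fun x => a x i j))
    (b_smooth : forall i : 'I_N, smooth_on U (fun x => b x 0 i))
    (g_smooth : smooth_on U g)
    (a_sign : forall x, U x -> lorentzian (a x))
    (b_norm : forall x, U x -> form_sqnorm (a x) (b x) = - c x ^+ 2)
    (c_range : forall x, U x -> 0 < c x <= 1)
    (x : 'rV[R]_N) (y : 'rV[R]_N)
    (x_in_U : U x)
    (y_in_sector : in_sector s (a x) (b x) (g x) y)
    (nu_neq0 : nuf s (a x) (b x) (g x) (c x) y != 0)
    (Csq_neq0 : Csq s (a x) (b x) (g x) y != 0)
    (i j m n : 'I_N) :
  let X := Xf s (a x) (b x) (g x) (c x) y in
  let CC := Csq s (a x) (b x) (g x) y in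
  let C k := Cvec s (a x) (b x) (g x) k y in
  let h k l := hang s (a x) (b x) (g x) k l y in
  Rhat_low s (a x) (b x) (g x) i j m n y =
    - CC * X ^+ 2 * (h i m * h j n - h i n * h j m)
    + X ^+ 2 * (N%:R - X^-1)
      * (C i * C m * h j n - C i * C n * h j m
         + C j * C n * h i m - C j * C m * h i n).
Proof.
have [a_sym _] := a_sign x x_in_U.
apply: indicatrix_curvature => //.
  exact: lorentzian_unitmx (a_sign x x_in_U).
exact: b_norm.
Qed.
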